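(* For every $n\ge 3$, $$p_2^3-\frac{n(n-1)}{(n-2)^2}p_3^2=\frac{6}{n(n-2)}T_n+\frac{1}{2n(n-2)}P_n+\frac{1}{4n(n-2)}Q_n+\frac{1}{8n(n-2)^2}R_n.$$ Consequently $\mathcal D_{n-3}^{(n)}$ belongs to the square-graph cone $\mathcal C_{n,6}$ for every $n\ge 3$.
   Context: Let $x_1,\dots,x_n$ be indeterminates, $\bar x=\frac1n\sum_i x_i$, $z_i=x_i-\bar x$, $p_r=\sum_{i=1}^n z_i^r$. With $\sum^*$ denoting summation over ordered tuples of pairwise distinct indices in $\{1,\dots,n\}$ (empty sums are $0$), define $$T_n=\sum_{1\le i<j<k\le n}(z_i-z_j)^2(z_j-z_k)^2(z_k-z_i)^2,\qquad P_n=\sum_{i,j,k,l}^{*}(z_i-z_j)^2(z_j-z_k)^2(z_k-z_l)^2,$$ $$Q_n=\sum_{i,j,k,l}^{*}(z_i-z_j)^4(z_k-z_l)^2,\qquad R_n=\sum_{i,j,k,l,m,s}^{*}(z_i-z_j)^2(z_k-z_l)^2(z_m-z_s)^2.$$ Let $P(t)=\prod_{i=1}^n(t-x_i)$ and $\mathcal D_k^{(n)}=\operatorname{disc}(P^{(k)})=(-1)^{m(m-1)/2}c^{-1}\operatorname{Res}(P^{(k)},P^{(k+1)})$, where $m=n-k$ and $c$ is the leading coefficient of $P^{(k)}$. For a loopless multigraph $G$ on the vertex set $\{1,\dots,n\}$ with chosen edge orientations, set $M_G=\prod_{(i,j)\in E(G)}(x_i-x_j)$ (edges counted with multiplicity)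 and $\widetilde G=\sum_{\sigma\in S_n}M_G(x_{\sigma(1)},\dots,x_{\sigma(n)})$. $G$ is a square graph if every edge has even multiplicity; its degree is the number of edges counted with multiplicity. The square-graph cone $\mathcal C_{n,d}$ is the set of all finite nonnegative real linear combinations of the polynomials $\widetilde G$ with $G$ a square graph of degree $d$ on $\{1,\dots,n\}$. *)

(* Defs.v *)
(* Mathematical Components, with multinomials.  The indeterminates x_1, ..., x_n
   are 'X_0, ..., 'X_(n-1) in {mpoly R[n]}; R is an arbitrary ordered field, in
   particular any model of the real numbers. *)
From mathcomp Require Import all_boot all_order all_fingroup all_algebra.
From mathcomp Require Export mpoly.

Set Implicit Arguments.
Unset Strict Implicit.
Unset Printing Implicit Defensive.

Import Order.TTheory GRing.Theory Num.Theory.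
Local Open Scope ring_scope.

Section CentredVariables.
Variables (R : realFieldType) (n : nat).

Definition xbar : {mpoly R[n]} := n%:R^-1 *: \sum_(i < n) 'X_i.

Definition z (i : 'I_n) : {mpoly R[n]} := 'X_i - xbar.

Definition psum (r : nat) : {mpoly R[n]} := \sum_(i < n) z i ^+ r.

Definition Tsum : {mpoly R[n]} :=
  \sum_(i < n) \sum_(j < n | (i < j)%N) \sum_(k < n | (j < k)%N)
    (z i - z j) ^+ 2 * (z j - z k) ^+ 2 * (z k - z i) ^+ 2.

Definition Psum : {mpoly R[n]} :=
  \sum_(i < n) \sum_(j < n) \sum_(k < n) \sum_(l < n | uniq [:: i; j; k; l])
    (z i - z j) ^+ 2 * (z j - z k) ^+ 2 * (z k - z l) ^+ 2.

Definition Qsum : {mpoly R[n]} :=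
  \sum_(i < n) \sum_(j < n) \sum_(k < n) \sum_(l < n | uniq [:: i; j; k; l])
    (z i - z j) ^+ 4 * (z k - z l) ^+ 2.

Definition Rsum : {mpoly R[n]} :=
  \sum_(i < n) \sum_(j < n) \sum_(k < n) \sum_(l < n) \sum_(m < n)
  \sum_(s < n | uniq [:: i; j; k; l; m; s])
    (z i - z j) ^+ 2 * (z k - z l) ^+ 2 * (z m - z s) ^+ 2.

End CentredVariables.

Section Discriminants.
Variables (R : realFieldType) (n : nat).

Definition rootpoly : {poly {mpoly R[n]}} := \prod_(i < n) ('X - ('X_i)%:P).

(* The leading coefficient of rootpoly^`(k) is a nonzero constant for k <= n,
   hence a unit of {mpoly R[n]}.  The matrix of [resultant f g] has its columns
   ordered by increasing degree and the rows of f before those of g, so it is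
   (-1) ^ (deg f * deg g) times the usual Res(f, g); the sign is trivial here
   since the degrees m and m - 1 have an even product. *)
Definition Ddisc (k : nat) : {mpoly R[n]} :=
  let m := (n - k)%N in
  (-1) ^+ (m * m.-1)./2 * (lead_coef rootpoly^`(k))^-1
  * resultant rootpoly^`(k) rootpoly^`(k.+1).

End Discriminants.

(* A loopless multigraph on 'I_n, given by its edge multiplicities, together with
   an orientation of the vertex pairs: [orient i j] means that an edge between i
   and j is directed from i to j.  All parallel edges thus share one orientation,
   so that M_G is a product of even powers when G is a square graph; orienting
   parallel edges independently would allow M_G to change sign. *)
Record multigraph (n : nat) := Multigraph {
  mult : 'I_n -> 'I_n -> nat;
  orient : rel 'I_n;
  mult_sym : forall i j, mult i j = mult j i;
  mult_loopless : forall i, mult i i = 0%N;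
  orient_tournament : forall i j, i != j -> orient i j = ~~ orient j i
}.

Section SquareGraphCone.
Variables (R : realFieldType) (n : nat).

Definition square_graph (G : multigraph n) : Prop :=
  forall i j, ~~ odd (mult G i j).

Definition degree (G : multigraph n) : nat :=
  (\sum_(i < n) \sum_(j < n | i < j) mult G i j)%N.

(* [orient i i] is unconstrained: the diagonal factors are 0 ^+ 0 = 1. *)
Definition graph_monomial (G : multigraph n) : {mpoly R[n]} :=
  \prod_(i < n) \prod_(j < n | orient G i j) ('X_i - 'X_j) ^+ mult G i j.

(* [msym s q] is q with each 'X_i replaced by 'X_(s i). *)
Definition graph_sym (G : multigraph n) : {mpoly R[n]} :=
  \sum_(s : 'S_n) msym s (graph_monomial G).

Definition square_graph_cone (d : nat) (f : {mpoly R[n]}) : Prop :=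
  exists (N : nat) (c : 'I_N -> R) (G : 'I_N -> multigraph n),
    (forall a, [/\ 0 <= c a, square_graph (G a) & degree (G a) = d])
    /\ f = \sum_(a < N) c a *: graph_sym (G a).

End SquareGraphCone.

Arguments xbar R n : clear implicits.
Arguments psum R n r : clear implicits.
Arguments Tsum R n : clear implicits.
Arguments Psum R n : clear implicits.
Arguments Qsum R n : clear implicits.
Arguments Rsum R n : clear implicits.
Arguments rootpoly R n : clear implicits.
Arguments Ddisc R n k : clear implicits.

(* Main.v *)
(* Put w_ij = (z_i - z_j)^2 and d_i = sum_j w_ij.  For any symmetric weights with
   zero diagonal, inclusion-exclusion expresses the sums of products of three
   weights over paths, over an edge plus a disjoint double edge, and over
   3-matchings through unrestricted sums of monomials in w_ij, d_i, d_j, together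
   with the triangle sum.  For squared differences of centred variables these are
   polynomials in n, p_2, p_3, p_4, p_6, and the identity is a ring identity.

   P^(n-3) is a cubic; its discriminant, computed from the Sylvester matrix and
   Newton's formulas, is a positive multiple of p_2^3 - n(n-1)/(n-2)^2 p_3^2.  This
   polynomial is symmetric, hence equal to its average over S_n; the right-hand
   side is a nonnegative combination of products of three squared differences, each
   of which is 0 or the monomial of a square graph, so averaging puts it in the
   cone. *)
Require Import Defs.
From mathcomp Require Import all_boot all_order all_fingroup all_algebra.
From mathcomp Require Import ring zify.
Import Order.TTheory GRing.Theory Num.Theory.
Local Open Scope ring_scope.

(** * Sums over distinct indices *)

Section DistinctIndices.
Variables (A : comNzRingType) (n : nat).
Implicit Types (s : seq 'I_n).

Lemma sum_notin s (F : 'I_n -> A) : uniq s ->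
  \sum_(i | i \notin s) F i = \sum_i F i - \sum_(i <- s) F i.
Proof.
by move=> us; rewrite [\sum_i _](bigID (mem s)) /= [\sum_(i <- s) _]big_uniq // addrAC
   subrr add0r.
Qed.

Lemma sum_uniq_rcons s (F : 'I_n -> A) : uniq s ->
  \sum_(i | uniq (rcons s i)) F i = \sum_i F i - \sum_(i <- s) F i.
Proof.
by move=> us; rewrite -sum_notin //; apply: eq_bigl => i; rewrite rcons_uniq us andbT.
Qed.

(** Inclusion-exclusion over an edge avoiding [s]: loops [k = l] carry weight 0, so only [k] and [l]
    outside [s] matters, and by symmetry the two single exclusions coincide, hence the factor 2. *)
Lemma sum_disjoint_edge s (G : 'I_n -> 'I_n -> A) :
    uniq s -> (forall i j, G i j = G j i) -> (forall i, G i i = 0) ->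
  \sum_k \sum_(l | uniq (rcons (rcons s k) l)) G k l
  = \sum_k \sum_l G k l - 2 * (\sum_(a <- s) \sum_l G a l)
    + \sum_(a <- s) \sum_(b <- s) G a b.
Proof.
move=> us Gsym G0.
transitivity (\sum_(k | k \notin s) \sum_(l | l \notin s) G k l).
  rewrite [RHS]big_mkcond /=; apply: eq_bigr => k _.
  case: ifP => ks; last first.
    by apply: big_pred0 => l; rewrite !rcons_uniq ks andbF.
  rewrite big_mkcond [RHS]big_mkcond; apply: eq_bigr => l _.
  rewrite !rcons_uniq us ks andbT mem_rcons inE negb_or.
  by have [->|_] /= := eqVneq l k; rewrite ?andbT //= G0 if_same.
rewrite sum_notin //.
under eq_bigr do rewrite sum_notin //.
under [X in _ - X]eq_bigr do rewrite sum_notin //.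
rewrite !sumrB.
have -> : \sum_k \sum_(l <- s) G k l = \sum_(a <- s) \sum_l G a l.
  by rewrite exchange_big; apply: eq_bigr => a _; apply: eq_bigr => b _; rewrite Gsym.
ring.
Qed.

(** The two transpositions generate all permutations of the arguments, so each unordered triple is
    counted 3! times, and [f] vanishes as soon as two indices agree. *)
Lemma sum_triples (f : 'I_n -> 'I_n -> 'I_n -> A) :
    (forall i j k, f i j k = f j i k) -> (forall i j k, f i j k = f i k j) ->
    (forall i k, f i i k = 0) ->
  \sum_i \sum_j \sum_k f i j k
  = 6 * \sum_(i < n) \sum_(j < n | (i < j)%N) \sum_(k < n | (j < k)%N) f i j k.
Proof.
move=> f12 f23 f0.
pose g (i j k : 'I_n) := if (i < j)%N && (j < k)%N then f i j k else 0.
have -> : \sum_(i < n) \sum_(j < n | (i < j)%N) \sum_(k < n | (j < k)%N) f i j k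
   = \sum_i \sum_j \sum_k g i j k.
  apply: eq_bigr => i _; rewrite big_mkcond; apply: eq_bigr => j _.
  case: ifP => ij; last by rewrite big1 // => k _; rewrite /g ij.
  by rewrite big_mkcond; apply: eq_bigr => k _; rewrite /g ij.
(* For distinct indices exactly one of the six orders is increasing; otherwise both sides are 0. *)
have fE i j k : f i j k =
    g i j k + g i k j + g j i k + g j k i + g k i j + g k j i.
  rewrite /g (f23 i k j) (f12 j i k) (f23 j k i) (f12 j i k) (f12 k i j).
  rewrite (f23 i k j) (f23 k j i) (f12 k i j) (f23 i k j).
  have f0' : i = j \/ j = k \/ i = k -> f i j k = 0.
    by case=> [->|[->|->]]; rewrite ?f0 // ?[f _ k k]f12 f23 ?f0 // f12 f0.
  case: (ltngtP i j) f0' => [ij|ij|/val_inj ij] f0';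
    case: (ltngtP j k) f0' => [jk|jk|/val_inj jk] f0';
    case: (ltngtP i k) f0' => [ik|ik|/val_inj ik] f0';
    rewrite /= ?addr0 ?add0r //; try (by rewrite f0'; tauto);
    exfalso; move: ij jk ik; clear; lia.
under eq_bigr do under eq_bigr do under eq_bigr do rewrite fE.
under eq_bigr do under eq_bigr do rewrite !big_split.
under eq_bigr do rewrite !big_split.
rewrite !big_split /=.
have E1 (h : 'I_n -> 'I_n -> 'I_n -> A) :
  \sum_i \sum_j \sum_k h j i k = \sum_i \sum_j \sum_k h i j k by rewrite exchange_big.
have E2 (h : 'I_n -> 'I_n -> 'I_n -> A) :
    \sum_i \sum_j \sum_k h i k j = \sum_i \sum_j \sum_k h i j k.
  by apply: eq_bigr => i _; rewrite exchange_big.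
rewrite (E2 g) (E1 g).
rewrite (E1 (fun i j k => g i k j)) (E2 g).
rewrite (E2 (fun i j k => g j i k)) (E1 g).
rewrite (E1 (fun i j k => g k i j)) (E2 (fun i j k => g j i k)) (E1 g).
ring.
Qed.

(** The starred sum over four indices, with the condition placed as in [Psum] and [Qsum]. *)
Definition distinct4 (F : 'I_n -> 'I_n -> 'I_n -> 'I_n -> A) : A :=
  \sum_i \sum_j \sum_k \sum_(l | uniq [:: i; j; k; l]) F i j k l.

(** Moving the condition into the summand makes the four ranges independent, so that the sums can be
    exchanged. *)
Lemma distinct4E F : distinct4 F =
  \sum_i \sum_j \sum_k \sum_l (if uniq [:: i; j; k; l] then F i j k l else 0).
Proof. by do 3![apply: eq_bigr => ? _]; rewrite big_mkcond. Qed.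

Lemma eq_distinct4 F G :
  (forall i j k l, uniq [:: i; j; k; l] -> F i j k l = G i j k l) ->
  distinct4 F = distinct4 G.
Proof. by move=> FG; do 4![apply: eq_bigr => ? ?]; apply: FG. Qed.

Lemma distinct4D F G :
  distinct4 (fun i j k l => F i j k l + G i j k l) = distinct4 F + distinct4 G.
Proof.
rewrite -big_split; apply: eq_bigr => i _; rewrite -big_split; apply: eq_bigr => j _.
by rewrite -big_split; apply: eq_bigr => k _; rewrite -big_split.
Qed.

Lemma distinct4Z c F : distinct4 (fun i j k l => c * F i j k l) = c * distinct4 F.
Proof. by rewrite mulr_sumr; do 3![apply: eq_bigr => ? _; rewrite mulr_sumr]. Qed.

Lemma distinct4_swap12 F : distinct4 (fun i j k l => F j i k l) = distinct4 F.
Proof.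
rewrite !distinct4E exchange_big; do 4![apply: eq_bigr => ? _].
by congr (if _ then _ else _); apply/perm_uniq/seq.permP => a /=; rewrite addnCA.
Qed.

Lemma distinct4_swap34 F : distinct4 (fun i j k l => F i j l k) = distinct4 F.
Proof.
rewrite !distinct4E; do 2![apply: eq_bigr => ? _].
rewrite exchange_big; do 2![apply: eq_bigr => ? _].
by congr (if _ then _ else _); apply/perm_uniq/seq.permP => a /=;
  rewrite [(a _ + (a _ + 0))%N]addnCA.
Qed.

Lemma distinct4_swap_pairs F : distinct4 (fun i j k l => F k l i j) = distinct4 F.
Proof.
rewrite !distinct4E.
under eq_bigr do rewrite exchange_big.
rewrite exchange_big; apply: eq_bigr => k _.
under eq_bigr do rewrite exchange_big.
rewrite exchange_big; do 3![apply: eq_bigr => ? _].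
congr (if _ then _ else _).
by rewrite -[[:: _; _; k; _]]/([:: _; _] ++ [:: k; _]) uniq_catC.
Qed.

End DistinctIndices.

(** * Path and matching sums of symmetric edge weights *)

Section EdgeWeights.
Variables (A : comNzRingType) (n : nat) (w : 'I_n -> 'I_n -> A).
Hypotheses (w_sym : forall i j, w i j = w j i) (w_diag : forall i, w i i = 0).

Let d i := \sum_j w i j.
Let W := \sum_i \sum_j w i j.
Let W2 := \sum_i \sum_j w i j ^+ 2.
Let W3 := \sum_i \sum_j w i j ^+ 3.
Let D2 := \sum_i d i ^+ 2.
Let D3 := \sum_i d i ^+ 3.
Let WD := \sum_i \sum_j w i j ^+ 2 * d i.
Let DWD := \sum_i \sum_j d i * w i j * d j.
Let triangles := \sum_i \sum_j \sum_k w i j * w j k * w k i.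

(** The end vertex [l] is summed first: it avoids [i], [j], [k], which leaves [d k - w k j - w k i].
    The first two terms give [DWD] and one [WD], the third closes a triangle, and the case [k = i]
    supplies the other [WD] and [W3]. *)
Lemma sum_path : distinct4 A n (fun i j k l => w i j * w j k * w k l)
  = DWD - 2 * WD + W3 - triangles.
Proof.
(* The last term corrects for [k = i], where the two others do not cancel. *)
have last_edge i j k :
    \sum_(l | uniq [:: i; j; k; l]) w i j * w j k * w k l
    = w i j * w j k * (d k - w k j) - w i j * w j k * w k i
      - (if k == i then w i j ^+ 2 * (d i - w i j) else 0).
  have [->|kNi] := eqVneq k i.
    rewrite big_pred0 => [|l]; last by rewrite /= !inE eqxx orbT.
    by rewrite w_diag [w j i]w_sym; ring.
  have [->|iNj] := eqVneq i j.
    by rewrite big1 => [|l _]; rewrite w_diag; ring.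
  have [->|jNk] := eqVneq j k.
    by rewrite big1 => [|l _]; rewrite w_diag; ring.
  rewrite (sum_uniq_rcons _ _ [:: i; j; k]); last first.
    by rewrite /= !inE negb_or iNj jNk [i == k]eq_sym kNi.
  rewrite !big_cons big_nil -mulr_sumr /= -/(d k) w_diag; ring.
transitivity (\sum_i \sum_j (w i j * (\sum_k w j k * d k)
   - w i j * (\sum_k w j k ^+ 2) - \sum_k w i j * w j k * w k i
   - (w i j ^+ 2 * d i - w i j ^+ 3))).
  apply: eq_bigr => i _; apply: eq_bigr => j _.
  under eq_bigr do rewrite last_edge.
  rewrite !sumrB -big_mkcond /= big_pred1_eq.
  have -> : \sum_k w i j * w j k * (d k - w k j)
      = w i j * (\sum_k w j k * d k) - w i j * (\sum_k w j k ^+ 2).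
    by rewrite -mulrBr -sumrB mulr_sumr; apply: eq_bigr => k _;
      rewrite [w k j]w_sym; ring.
  ring.
under eq_bigr do rewrite !sumrB; rewrite !sumrB.
have -> : \sum_i \sum_j w i j * (\sum_k w j k * d k) = DWD.
  rewrite exchange_big; apply: eq_bigr => j _ /=.
  rewrite -mulr_suml mulr_sumr; apply: eq_bigr => k _.
  by rewrite mulrA; congr (_ * _ * _); apply: eq_bigr => i _.
have -> : \sum_i \sum_j w i j * (\sum_k w j k ^+ 2) = WD.
  rewrite exchange_big; apply: eq_bigr => j _ /=.
  rewrite -mulr_suml mulr_sumr; apply: eq_bigr => k _.
  by rewrite mulrC; congr (_ * _); apply: eq_bigr => i _.
rewrite -/triangles -/WD -/W3; ring.
Qed.

(** [sum_disjoint_edge] for [[:: i; j]]. The first factor stays general because the three-edge sum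
    needs it as a weight, a squared weight and a weight times a degree. *)
Lemma sum_matching2 (f : 'I_n -> 'I_n -> A) : (forall i, f i i = 0) ->
  distinct4 A n (fun i j k l => f i j * w k l)
  = \sum_i \sum_j f i j * (W - 2 * d i - 2 * d j + 2 * w i j).
Proof.
move=> f0; apply: eq_bigr => i _; apply: eq_bigr => j _.
under eq_bigr do rewrite -mulr_sumr; rewrite -mulr_sumr.
have [->|iNj] := eqVneq i j; first by rewrite f0 !mul0r.
congr (_ * _).
rewrite (sum_disjoint_edge _ _ [:: i; j] w) //=; last by rewrite inE iNj.
rewrite !big_cons !big_nil !w_diag [w j i]w_sym /= -/(d _) -/(d _) -/W; ring.
Qed.

Lemma sum_matching2_sq : distinct4 A n (fun i j k l => w i j ^+ 2 * w k l)
  = W * W2 - 4 * WD + 2 * W3.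
Proof.
rewrite (sum_matching2 (fun i j => w i j ^+ 2)) => [|i]; last by rewrite w_diag expr0n.
(* With [w j i] in the third term, exchanging the sums identifies it with the second. *)
transitivity (\sum_i \sum_j (W * w i j ^+ 2 - 2 * (w i j ^+ 2 * d i)
    - 2 * (w j i ^+ 2 * d j) + 2 * w i j ^+ 3)).
  by do 2![apply: eq_bigr => ? _]; rewrite [w _ _ in X in _ = _ - X + _]w_sym; ring.
under eq_bigr do rewrite !big_split /= !sumrN -!mulr_sumr.
rewrite !big_split /= !sumrN -!mulr_sumr -/W2 -/W3 -/WD exchange_big /= -/WD; ring.
Qed.

Lemma sum_matching2_w : distinct4 A n (fun i j k l => w i j * w k l)
  = W ^+ 2 - 4 * D2 + 2 * W2.
Proof.
rewrite sum_matching2 //.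
transitivity (\sum_i \sum_j (W * w i j - 2 * (w i j * d i)
    - 2 * (w j i * d j) + 2 * w i j ^+ 2)).
  by do 2![apply: eq_bigr => ? _]; rewrite [w _ _ in X in _ = _ - X + _]w_sym; ring.
under eq_bigr do rewrite !big_split /= !sumrN -!mulr_sumr.
rewrite !big_split /= !sumrN -!mulr_sumr [\sum_i \sum_j w j i * _]exchange_big /=.
have -> : \sum_i \sum_j w i j * d i = D2.
  by apply: eq_bigr => i _; rewrite -mulr_suml expr2.
rewrite -/W -/W2; ring.
Qed.

Lemma sum_matching2_deg : distinct4 A n (fun i j k l => w i j * d i * w k l)
  = W * D2 - 2 * D3 - 2 * DWD + 2 * WD.
Proof.
rewrite (sum_matching2 (fun i j => w i j * d i)) => [|i]; last by rewrite w_diag mul0r.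
transitivity (\sum_i \sum_j (W * (w i j * d i) - 2 * (w i j * d i ^+ 2)
    - 2 * (d i * w i j * d j) + 2 * (w i j ^+ 2 * d i))).
  by do 2![apply: eq_bigr => ? _]; ring.
under eq_bigr do rewrite !big_split /= !sumrN -!mulr_sumr.
rewrite !big_split /= !sumrN -!mulr_sumr -/DWD -/WD.
have -> : \sum_i \sum_j w i j * d i = D2.
  by apply: eq_bigr => i _; rewrite -mulr_suml expr2.
have -> // : \sum_i \sum_j w i j * d i ^+ 2 = D3.
by apply: eq_bigr => i _; rewrite -mulr_suml exprS.
Qed.

(** Removing the vertices [i], [j], [k], [l] from the third edge leaves [W], minus twice four
    degrees, plus twice six weights. Each degree marks an end of one of the two edges ([e1]), two of
    the weights repeat an edge ([e2]), and the four cross weights join the edges into paths ([e3]).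
    Relabelling makes equal all sums of one kind, whence the coefficients 8, 4 and 8. *)
Lemma sum_matching3 :
  distinct4 A n (fun i j k l =>
    \sum_m \sum_(s | uniq [:: i; j; k; l; m; s]) w i j * w k l * w m s)
  = W * (W ^+ 2 - 4 * D2 + 2 * W2) - 8 * (W * D2 - 2 * D3 - 2 * DWD + 2 * WD)
    + 4 * (W * W2 - 4 * WD + 2 * W3)
    + 8 * (DWD - 2 * WD + W3 - triangles).
Proof.
rewrite -sum_path -sum_matching2_sq -sum_matching2_w -sum_matching2_deg.
pose e1 i j k l := w i j * d i * w k l.
pose e2 i j k l := w i j ^+ 2 * w k l.
pose e3 i j k l := w i j * w j k * w k l.
transitivity (distinct4 A n (fun i j k l =>
   W * (w i j * w k l) + (-2) * (e1 i j k l + e1 j i k l + (e1 k l i j + e1 l k i j))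
   + 2 * (e2 i j k l + e2 k l i j)
   + 2 * (e3 i j k l + e3 j i k l + (e3 i j l k + e3 j i l k)))).
  apply: eq_distinct4 => i j k l u.
  under eq_bigr do rewrite -mulr_sumr; rewrite -mulr_sumr.
  rewrite (sum_disjoint_edge _ _ [:: i; j; k; l] w) //.
  rewrite !big_cons !big_nil !w_diag /e1 /e2 /e3 -/W -!/(d _).
  rewrite [w j i]w_sym [w k i]w_sym [w k j]w_sym [w l i]w_sym [w l j]w_sym [w l k]w_sym.
  ring.
rewrite !distinct4D !distinct4Z !distinct4D.
rewrite (distinct4_swap_pairs _ _ e2) (distinct4_swap_pairs _ _ e1).
rewrite (distinct4_swap_pairs _ _ (fun i j k l => e1 j i k l)).
rewrite (distinct4_swap12 _ _ (fun i j k l => e3 i j l k)).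
rewrite !(distinct4_swap12 _ _ e1) (distinct4_swap12 _ _ e3) (distinct4_swap34 _ _ e3).
rewrite /e1 /e2 /e3; ring.
Qed.

End EdgeWeights.

(** * Power sums of centred variables *)

Section PowerSums.
Variables (A : comNzRingType) (n : nat) (z : 'I_n -> A).

Let p r := \sum_i z i ^+ r.

(** The list [s] is a polynomial in [z i], given by coefficient and exponent; supplying it
    explicitly reduces each use to goals for [ring]. *)
Lemma sum1_monomials (s : seq (A * nat)) (F : 'I_n -> A) :
    (forall i, F i = \sum_(t <- s) t.1 * z i ^+ t.2) ->
  \sum_i F i = \sum_(t <- s) t.1 * p t.2.
Proof.
move=> FE; under eq_bigr do rewrite FE.
by rewrite exchange_big; apply: eq_bigr => t _; rewrite mulr_sumr.
Qed.

Lemma sum2_monomials (s : seq (A * (nat * nat))) (F : 'I_n -> 'I_n -> A) :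
    (forall i j, F i j = \sum_(t <- s) t.1 * (z i ^+ t.2.1 * z j ^+ t.2.2)) ->
  \sum_i \sum_j F i j = \sum_(t <- s) t.1 * (p t.2.1 * p t.2.2).
Proof.
move=> FE; under eq_bigr do under eq_bigr do rewrite FE.
under eq_bigr do rewrite exchange_big; rewrite exchange_big; apply: eq_bigr => t _ /=.
under eq_bigr do rewrite -mulr_sumr -mulr_sumr.
by rewrite -mulr_sumr -mulr_suml.
Qed.

Hypothesis p1 : p 1 = 0.

Let w i j := (z i - z j) ^+ 2.
Let d i := \sum_j w i j.

Lemma psum0 : p 0 = n%:R.
Proof. by rewrite /p (eq_bigr (fun=> 1)) // sumr_const card_ord. Qed.

Lemma sqdiff_degree i : d i = n%:R * z i ^+ 2 + p 2.
Proof.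
rewrite /d /w (sum1_monomials [:: (z i ^+ 2, 0%N); (-2 * z i, 1%N); (1, 2%N)]) => [|j].
  by rewrite !big_cons big_nil /w /= ?p1 ?psum0; ring.
by rewrite !big_cons big_nil /=; ring.
Qed.

(** Here and below the lists are binomial expansions of even powers of [z i - z j], multiplied out
    with the degrees where these occur. Exponent 1 contributes 0 by [p1], exponent 0 contributes
    [n]. *)
Lemma sum_sqdiff : \sum_i \sum_j w i j = 2 * n%:R * p 2.
Proof.
rewrite (sum2_monomials [:: (1, (2, 0)%N); (-2, (1, 1)%N); (1, (0, 2)%N)]) => [|i j];
  rewrite !big_cons big_nil /w /= ?p1 ?psum0; ring.
Qed.

Lemma sum_sqdiff2 : \sum_i \sum_j w i j ^+ 2 = 2 * n%:R * p 4 + 6 * p 2 ^+ 2.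
Proof.
rewrite (sum2_monomials
  [:: (1, (4, 0)%N); (-4, (3, 1)%N); (6, (2, 2)%N); (-4, (1, 3)%N); (1, (0, 4)%N)]) => [|i j];
  rewrite !big_cons big_nil /w /= ?p1 ?psum0; ring.
Qed.

Lemma sum_sqdiff3 :
  \sum_i \sum_j w i j ^+ 3 = 2 * n%:R * p 6 + 30 * p 2 * p 4 - 20 * p 3 ^+ 2.
Proof.
rewrite (sum2_monomials
  [:: (1, (6, 0)%N); (-6, (5, 1)%N); (15, (4, 2)%N); (-20, (3, 3)%N); (15, (2, 4)%N);
      (-6, (1, 5)%N); (1, (0, 6)%N)]) => [|i j];
  rewrite !big_cons big_nil /w /= ?p1 ?psum0; ring.
Qed.

Lemma sum_degree2 : \sum_i d i ^+ 2 = n%:R ^+ 2 * p 4 + 3 * n%:R * p 2 ^+ 2.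
Proof.
under eq_bigr do rewrite sqdiff_degree.
rewrite (sum1_monomials [:: (n%:R ^+ 2, 4%N); (2 * n%:R * p 2, 2%N); (p 2 ^+ 2, 0%N)]) => [|i];
  rewrite !big_cons big_nil /w /= ?p1 ?psum0; ring.
Qed.

Lemma sum_degree3 : \sum_i d i ^+ 3
  = n%:R ^+ 3 * p 6 + 3 * n%:R ^+ 2 * p 2 * p 4 + 4 * n%:R * p 2 ^+ 3.
Proof.
under eq_bigr do rewrite sqdiff_degree.
rewrite (sum1_monomials [:: (n%:R ^+ 3, 6%N); (3 * n%:R ^+ 2 * p 2, 4%N);
   (3 * n%:R * p 2 ^+ 2, 2%N); (p 2 ^+ 3, 0%N)]) => [|i];
  rewrite !big_cons big_nil /w /= ?p1 ?psum0; ring.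
Qed.

Lemma sum_sqdiff2_degree : \sum_i \sum_j w i j ^+ 2 * d i
  = n%:R ^+ 2 * p 6 + 9 * n%:R * p 2 * p 4 - 4 * n%:R * p 3 ^+ 2 + 6 * p 2 ^+ 3.
Proof.
under eq_bigr do under eq_bigr do rewrite sqdiff_degree.
rewrite (sum2_monomials
  [:: (n%:R, (6, 0)%N); (-4 * n%:R, (5, 1)%N); (6 * n%:R, (4, 2)%N);
      (-4 * n%:R, (3, 3)%N);
      (n%:R, (2, 4)%N); (p 2, (4, 0)%N); (-4 * p 2, (3, 1)%N); (6 * p 2, (2, 2)%N);
      (-4 * p 2, (1, 3)%N); (p 2, (0, 4)%N)]) => [|i j];
  rewrite !big_cons big_nil /w /= ?p1 ?psum0; ring.
Qed.

Lemma sum_degree_sqdiff_degree : \sum_i \sum_j d i * w i j * d j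
  = 4 * n%:R ^+ 2 * p 2 * p 4 - 2 * n%:R ^+ 2 * p 3 ^+ 2 + 4 * n%:R * p 2 ^+ 3.
Proof.
under eq_bigr do under eq_bigr do rewrite !sqdiff_degree.
rewrite (sum2_monomials
  [:: (n%:R ^+ 2, (4, 2)%N); (-2 * n%:R ^+ 2, (3, 3)%N); (n%:R ^+ 2, (2, 4)%N);
      (n%:R * p 2, (4, 0)%N); (-2 * n%:R * p 2, (3, 1)%N); (2 * n%:R * p 2, (2, 2)%N);
      (-2 * n%:R * p 2, (1, 3)%N); (n%:R * p 2, (0, 4)%N);
      (p 2 ^+ 2, (2, 0)%N); (-2 * p 2 ^+ 2, (1, 1)%N); (p 2 ^+ 2, (0, 2)%N)]) => [|i j];
  rewrite !big_cons big_nil /w /= ?p1 ?psum0; ring.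
Qed.

Lemma sum_sqdiff_triangle : \sum_i \sum_j \sum_k w i j * w j k * w k i
  = 6 * (n%:R * p 2 * p 4 - p 2 ^+ 3 - n%:R * p 3 ^+ 2).
Proof.
(* As a function of [z k], the product [w j k * w k i] is the square of the monic quadratic with
   roots [z i] and [z j]; its linear term disappears on summation. *)
have third i j : \sum_k w i j * w j k * w k i
   = (z i - z j) ^+ 2 * (n%:R * z i ^+ 2 * z j ^+ 2
     + p 2 * (z i ^+ 2 + z j ^+ 2 + 4 * z i * z j) - 2 * p 3 * (z i + z j) + p 4).
  rewrite (sum1_monomials [:: (w i j * z i ^+ 2 * z j ^+ 2, 0%N);
     (-2 * w i j * z i * z j * (z i + z j), 1%N);
     (w i j * (z i ^+ 2 + z j ^+ 2 + 4 * z i * z j), 2%N);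
     (-2 * w i j * (z i + z j), 3%N); (w i j, 4%N)]) => [|k];
  rewrite !big_cons big_nil /w /= ?p1 ?psum0; ring.
under eq_bigr do under eq_bigr do rewrite third.
rewrite (sum2_monomials
  [:: (n%:R, (4, 2)%N); (-2 * n%:R, (3, 3)%N); (n%:R, (2, 4)%N);
      (p 2, (4, 0)%N); (2 * p 2, (3, 1)%N); (-6 * p 2, (2, 2)%N); (2 * p 2, (1, 3)%N);
      (p 2, (0, 4)%N);
      (-2 * p 3, (3, 0)%N); (2 * p 3, (2, 1)%N); (2 * p 3, (1, 2)%N);
      (-2 * p 3, (0, 3)%N);
      (p 4, (2, 0)%N); (-2 * p 4, (1, 1)%N); (p 4, (0, 2)%N)]) => [|i j];
  rewrite !big_cons big_nil /w /= ?p1 ?psum0; ring.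
Qed.

(** The identity multiplied by [8 n (n - 2)^2], hence free of division. The triangle sum runs over
    ordered triples, which absorbs a factor 6. On the right [p 4] and [p 6] cancel. *)
Lemma power_sum_identity :
  8 * n%:R * ((n%:R - 2) ^+ 2 * p 2 ^+ 3 - n%:R * (n%:R - 1) * p 3 ^+ 2)
  = 8 * (n%:R - 2) * \sum_i \sum_j \sum_k w i j * w j k * w k i
    + 4 * (n%:R - 2) * distinct4 A n (fun i j k l => w i j * w j k * w k l)
    + 2 * (n%:R - 2) * distinct4 A n (fun i j k l => w i j ^+ 2 * w k l)
    + distinct4 A n (fun i j k l =>
        \sum_m \sum_(s | uniq [:: i; j; k; l; m; s]) w i j * w k l * w m s).
Proof.
have ws i j : w i j = w j i by rewrite /w; ring.
have w0 i : w i i = 0 by rewrite /w; ring.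
rewrite sum_matching3 // sum_matching2_sq // sum_path // -!/(d _).
under [\sum_i (\sum_j w i j) ^+ 2]eq_bigr do rewrite -/(d _).
rewrite sum_sqdiff sum_sqdiff2 sum_sqdiff3 sum_degree2 sum_degree3.
rewrite sum_sqdiff2_degree sum_degree_sqdiff_degree sum_sqdiff_triangle.
ring.
Qed.

End PowerSums.

Lemma sum_z (R : realFieldType) (n : nat) : (0 < n)%N -> \sum_(i < n) z R i = 0.
Proof.
move=> n_gt0; rewrite sumrB sumr_const card_ord /xbar -scaler_nat scalerA.
by rewrite divff ?scale1r ?subrr // pnatr_eq0 -lt0n.
Qed.

Lemma psum_identity (R : realFieldType) (n : nat) : (3 <= n)%N ->
  psum R n 2 ^+ 3
    - (n%:R * (n%:R - 1) / (n%:R - 2) ^+ 2) *: psum R n 3 ^+ 2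
  = (6 / (n%:R * (n%:R - 2))) *: Tsum R n
    + (1 / (2 * n%:R * (n%:R - 2))) *: Psum R n
    + (1 / (4 * n%:R * (n%:R - 2))) *: Qsum R n
    + (1 / (8 * n%:R * (n%:R - 2) ^+ 2)) *: Rsum R n.
Proof.
move=> n_ge3.
have n_neq0 : n%:R != 0 :> R by rewrite pnatr_eq0; lia.
have n2_neq0 : n%:R - 2 != 0 :> R by rewrite subr_eq0 eqr_nat; lia.
have n_gt0 : (0 < n)%N by lia.
have := @power_sum_identity _ n (@z R n) (sum_z _ _ n_gt0).
have -> : \sum_i \sum_j \sum_k (z R i - z R j) ^+ 2 * (z R j - z R k) ^+ 2
       * (z R k - z R i) ^+ 2 = 6 * Tsum R n.
  by rewrite (sum_triples _ n (fun i j k => _)) // => *; ring.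
have -> : distinct4 {mpoly R[n]} n (fun i j k l =>
    ((z R i - z R j) ^+ 2) ^+ 2 * (z R k - z R l) ^+ 2) = Qsum R n.
  by apply: eq_distinct4 => i j k l _; rewrite -exprM.
have -> : distinct4 {mpoly R[n]} n (fun i j k l =>
    \sum_m \sum_(s | uniq [:: i; j; k; l; m; s])
     (z R i - z R j) ^+ 2 * (z R k - z R l) ^+ 2 * (z R m - z R s) ^+ 2) = Rsum R n.
  rewrite distinct4E; do 4![apply: eq_bigr => ? _].
  (* [distinct4] already asks the first four indices to be distinct; if they are not, the inner sums
     of [Rsum] are empty, since a prefix of a duplicate-free list is duplicate-free. *)
  case: ifP => // nu; rewrite big1 // => m _; rewrite big_pred0 // => s.
  apply: contraFF nu; apply: (@subseq_uniq _ _ [:: _; _; _; _; _; _]).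
  exact: (prefix_subseq [:: _; _; _; _] [:: m; s]).
have -> : distinct4 {mpoly R[n]} n (fun i j k l =>
    (z R i - z R j) ^+ 2 * (z R j - z R k) ^+ 2 * (z R k - z R l) ^+ 2) = Psum R n by [].
rewrite -!/(psum R n _) => E.
(* Every scalar becomes [c] times an integer polynomial in [n], so that [ring] can work over the
   polynomial ring with [c] as an atom. *)
set c : R := (8 * n%:R * (n%:R - 2) ^+ 2)^-1.
have -> : n%:R * (n%:R - 1) / (n%:R - 2) ^+ 2 = c * (8 * n%:R * (n%:R * (n%:R - 1))).
  by rewrite /c; field; rewrite n_neq0 ?n2_neq0.
have -> : 6 / (n%:R * (n%:R - 2)) = c * (48 * (n%:R - 2)).
  by rewrite /c; field; rewrite n_neq0 ?n2_neq0.
have -> : 1 / (2 * n%:R * (n%:R - 2)) = c * (4 * (n%:R - 2)).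
  by rewrite /c; field; rewrite n_neq0 ?n2_neq0.
have -> : 1 / (4 * n%:R * (n%:R - 2)) = c * (2 * (n%:R - 2)).
  by rewrite /c; field; rewrite n_neq0 ?n2_neq0.
have -> : 1 / (8 * n%:R * (n%:R - 2) ^+ 2) = c by rewrite div1r.
have -> : psum R n 2 ^+ 3 = (c * (8 * n%:R * (n%:R - 2) ^+ 2)) *: psum R n 2 ^+ 3.
  by rewrite [c * _](_ : _ = 1) ?scale1r // /c; field; rewrite n_neq0 ?n2_neq0.
rewrite -!mul_mpolyC !(rmorphM, rmorphB, rmorphXn, rmorph_nat) /=.
transitivity (c%:MP_[n] * (8 * n%:R * ((n%:R - 2) ^+ 2 * psum R n 2 ^+ 3
   - n%:R * (n%:R - 1) * psum R n 3 ^+ 2))); first by ring.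
by rewrite E; ring.
Qed.

(** * The discriminant of the cubic derivative *)

Section LaplaceExpansion.
Variable A : comNzRingType.

(* The determinant of the matrix [f i j], in a form that reduces for a numeral [n]. *)
Fixpoint laplace_det (n : nat) (f : nat -> nat -> A) : A :=
  if n is m.+1 then
    foldr (fun j a => (-1) ^+ j * f 0%N j
        * laplace_det m (fun i k => f i.+1 (if (j <= k)%N then k.+1 else k)) + a)
      0 (iota 0 m.+1)
  else 1.

Lemma det_matrix_nat (n : nat) (f : nat -> nat -> A) :
  \det (\matrix_(i < n, j < n) f i j) = laplace_det n f.
Proof.
elim: n f => [|n IH] f; first by rewrite det_mx00.
pose F j := (-1) ^+ j * f 0%N j
  * laplace_det n (fun i k => f i.+1 (if (j <= k)%N then k.+1 else k)).
have -> : laplace_det n.+1 f = \sum_(j < n.+1) F j.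
  by rewrite -(big_mkord xpredT F) /index_iota subn0 unlock.
rewrite (expand_det_row _ ord0); apply: eq_bigr => j _.
rewrite /F -IH mxE /cofactor add0n mulrCA mulrA; congr (_ * \det _).
by apply/matrixP => i k; rewrite !mxE /= /bump leq0n add1n; case: leqP => _;
  rewrite ?add1n ?add0n.
Qed.

End LaplaceExpansion.

(** The sizes of [p] and [q] occur in the type of the Sylvester matrix; eliminating the two
    equations turns its dimension into [a + b], which can then be a numeral. *)
Lemma resultant_matrix (A : nzRingType) (p q : {poly A}) (a b : nat) :
    size p = b.+1 -> size q = a.+1 ->
  resultant p q = \det (\matrix_(i < a + b, j < a + b)
    (if (i < a)%N then p`_(j - i) *+ (i <= j) else q`_(j - (i - a)) *+ (i - a <= j))).
Proof.
move=> sp sq; rewrite /resultant.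
have ea : (size q).-1 = a by rewrite sq.
have eb : (size p).-1 = b by rewrite sp.
case: _ / ea; case: _ / eb; congr (\det _); apply/matrixP => i j.
by rewrite Sylvester_mxE mxE; case: splitP => k -> //=; rewrite addKn.
Qed.

Lemma resultant_cubic_deriv (A : comNzRingType) (p : {poly A}) :
    size p = 4 -> 3 * p`_3 != 0 ->
  resultant p p^`() = - p`_3 * (p`_2 ^+ 2 * p`_1 ^+ 2 - 4 * p`_3 * p`_1 ^+ 3
    - 4 * p`_2 ^+ 3 * p`_0 - 27 * p`_3 ^+ 2 * p`_0 ^+ 2
    + 18 * p`_3 * p`_2 * p`_1 * p`_0).
Proof.
move=> sp p3_neq0; set q := p^`().
have q0 : q`_0 = p`_1 by rewrite coef_deriv.
have q1 : q`_1 = 2 * p`_2 by rewrite coef_deriv mulr_natl.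
have q2 : q`_2 = 3 * p`_3 by rewrite coef_deriv mulr_natl.
have q_high i : (3 <= i)%N -> q`_i = 0.
  by move=> ?; rewrite coef_deriv nth_default ?mul0rn // sp.
have sq : size q = 3.
  apply/eqP; rewrite eqn_leq; apply/andP; split.
    by apply/leq_sizeP => i; apply: q_high.
  by rewrite ltnNge; apply: contra_neqN p3_neq0 => /leq_sizeP h; rewrite -q2 h.
rewrite (resultant_matrix _ _ _ 2 3) //.
pose rows : seq (seq A) :=
  [:: [:: p`_0; p`_1; p`_2; p`_3; 0]; [:: 0; p`_0; p`_1; p`_2; p`_3];
      [:: q`_0; q`_1; q`_2; 0; 0]; [:: 0; q`_0; q`_1; q`_2; 0];
      [:: 0; 0; q`_0; q`_1; q`_2]].
rewrite (_ : \matrix_(i, j) _ = \matrix_(i < 5, j < 5) (nth [::] rows i)`_j).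
  rewrite (det_matrix_nat _ 5 (fun i j => (nth [::] rows i)`_j)) /= q0 q1 q2; ring.
apply/matrixP => i j; rewrite !mxE.
have p4 : p`_4 = 0 by rewrite nth_default ?sp.
have q3 := q_high 3 isT; have q4 := q_high 4 isT.
by case: i => [[|[|[|[|[|//]]]]] ?]; case: j => [[|[|[|[|[|//]]]]] ?] /=;
  rewrite ?p4 ?q3 ?q4.
Qed.

(** * Newton's formulas for the top coefficients, and centring *)

Lemma coef_XsubCM (A : comNzRingType) (x : A) (q : {poly A}) (i : nat) :
  (('X - x%:P) * q)`_i.+1 = q`_i - x * q`_i.+1.
Proof. by rewrite mulrBl coefB coefXM coefCM. Qed.

Lemma coef1_prod_XsubC (A : idomainType) (s : seq A) (j : nat) : j.+1 = size s ->
  (\prod_(x <- s) ('X - x%:P))`_j = - \sum_(x <- s) x.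
Proof. by move=> js; rewrite -coefPn_prod_XsubC -?js. Qed.

(** Newton's formula for twice the second elementary symmetric polynomial, proved by splitting off
    one root; the factor 2 avoids division. *)
Lemma coef2_prod_XsubC (A : idomainType) (s : seq A) (j : nat) : j.+2 = size s ->
  2 * (\prod_(x <- s) ('X - x%:P))`_j
  = (\sum_(x <- s) x) ^+ 2 - \sum_(x <- s) x ^+ 2.
Proof.
elim: s j => [//|x s IH] [|j] [js].
  case: s js {IH} => [|y []] // _; rewrite !big_cons !big_nil -horner_coef0 /=.
  by rewrite !hornerE /=; ring.
rewrite !big_cons coef_XsubCM mulrBr IH // mulrCA coef1_prod_XsubC //; ring.
Qed.

Lemma coef3_prod_XsubC (A : idomainType) (s : seq A) (j : nat) : j.+3 = size s ->
  6 * (\prod_(x <- s) ('X - x%:P))`_j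
  = - ((\sum_(x <- s) x) ^+ 3 - 3 * (\sum_(x <- s) x) * (\sum_(x <- s) x ^+ 2)
       + 2 * \sum_(x <- s) x ^+ 3).
Proof.
elim: s j => [//|x s IH] [|j] [js].
  case: s js {IH} => [|y [|t []]] // _; rewrite !big_cons !big_nil -horner_coef0 /=.
  by rewrite !hornerE /=; ring.
rewrite !big_cons coef_XsubCM mulrBr IH //.
have := coef2_prod_XsubC _ s j.+1 js; set q := nth _ _ _ => E.
(* [q] is the second elementary symmetric polynomial of the remaining roots, known only through its
   double. *)
have -> : 6 * (x * q) = 3 * x * (2 * q) by ring.
rewrite E; ring.
Qed.

(** Binomial expansion of [z i + xb], the first centred power sum being 0. The mean stays a symbol:
    it cancels in the discriminant, which is invariant under translation. *)
Lemma psum_shift (R : realFieldType) (n : nat) (xb := xbar R n) : (0 < n)%N ->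
  [/\ \sum_(i < n) 'X_i = n%:R * xb,
      \sum_(i < n) 'X_i ^+ 2 = psum R n 2 + n%:R * xb ^+ 2 &
      \sum_(i < n) 'X_i ^+ 3 = psum R n 3 + 3 * xb * psum R n 2 + n%:R * xb ^+ 3].
Proof.
move=> n_gt0; have s0 := sum_z R n n_gt0.
have const (c : {mpoly R[n]}) : \sum_(i < n) c = n%:R * c.
  by rewrite sumr_const card_ord mulr_natl.
have X_z i : 'X_i = z R i + xb by rewrite /z subrK.
split.
- under eq_bigr do rewrite X_z.
  by rewrite big_split /= const s0 add0r.
- rewrite (eq_bigr (fun i => z R i ^+ 2 + 2 * xb * z R i + xb ^+ 2)) => [|i _].
    by rewrite !big_split /= -mulr_sumr s0 mulr0 addr0 const.
  by rewrite X_z; ring.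
rewrite (eq_bigr (fun i =>
    z R i ^+ 3 + 3 * xb * z R i ^+ 2 + 3 * xb ^+ 2 * z R i + xb ^+ 3)) => [|i _].
  rewrite !big_split /= -!mulr_sumr s0 mulr0 addr0 const /psum; ring.
by rewrite X_z; ring.
Qed.

Lemma Ddisc_psum (R : realFieldType) (m : nat) (n := m.+3) :
  Ddisc R n m = (n%:R * (n%:R - 1) * ((n%:R - 2) * m`!%:R) ^+ 4 / 12) *:
     (psum R n 2 ^+ 3 - (n%:R * (n%:R - 1) / (n%:R - 2) ^+ 2) *: psum R n 3 ^+ 2).
Proof.
pose s := [seq 'X_i | i <- enum 'I_n] : seq {mpoly R[n]}.
have size_s : size s = n by rewrite size_map size_enum_ord.
have sum_s (F : _ -> {mpoly R[n]}) : \sum_(x <- s) F x = \sum_(i < n) F 'X_i.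
  by rewrite big_map big_enum.
have [s1 s2 s3] := psum_shift R n isT.
rewrite -!(sum_s (fun x => x ^+ _)) -(sum_s id) in s1 s2 s3.
pose P := (rootpoly R n)^`(m).
(* [c i] is the factor (m + i)! / i! picked up by differentiating 'X^(m + i) m times. *)
pose c i : {mpoly R[n]} := ((m + i) ^_ m)%:R.
have c_fact i : i`!%:R * c i = (m + i)`!%:R.
  by rewrite -natrM mulnC -[X in (_ * X`!)%N](addKn m) ffact_fact ?leq_addr.
have P_coef i : P`_i = c i * (\prod_(x <- s) ('X - x%:P))`_(m + i).
  by rewrite /P coef_derivn /rootpoly big_map big_enum mulr_natl.
have nE : n%:R = m%:R + 3 :> {mpoly R[n]} by rewrite /n -addn3 natrD.
have c0 : c 0%N = m`!%:R by rewrite /c addn0 ffactnn.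
have c1 : c 1%N = (n%:R - 2) * m`!%:R.
  rewrite nE; have := c_fact 1%N; rewrite mul1r addn1 factS natrM -natr1 => ->; ring.
have c2 : 2 * c 2%N = (n%:R - 1) * (n%:R - 2) * m`!%:R.
  rewrite nE; have := c_fact 2%N; rewrite addn2 !factS !natrM -!natr1 => E.
  (* The sums of ones are 2! in the unfolded form in which it occurs in [E]; likewise 3! for
     [c 3]. *)
  transitivity ((0 + 1 + 1) * ((0 + 1) * (0 + 1)) * c 2%N); first by ring.
  by rewrite E; ring.
have c3 : 6 * c 3%N = n%:R * (n%:R - 1) * (n%:R - 2) * m`!%:R.
  rewrite nE; have := c_fact 3%N; rewrite addn3 !factS !natrM -!natr1 => E.
  transitivity ((0 + 1 + 1 + 1) * ((0 + 1 + 1) * ((0 + 1) * (0 + 1))) * c 3%N).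
    by ring.
  by rewrite E; ring.
set e1 := \sum_(x <- s) x in s1; set e2 := \sum_(x <- s) x ^+ 2 in s2.
set e3 := \sum_(x <- s) x ^+ 3 in s3.
have P3 : 6 * P`_3 = n%:R * (n%:R - 1) * (n%:R - 2) * m`!%:R.
  rewrite P_coef -c3; have /monicP := monic_prod_XsubC s xpredT id.
  by rewrite /lead_coef size_prod_XsubC size_s addn3 /= => ->; rewrite mulr1.
have P2 : 2 * P`_2 = - ((n%:R - 1) * (n%:R - 2) * m`!%:R * e1).
  by rewrite P_coef coef1_prod_XsubC ?size_s ?addn2 // mulrA c2 mulrN.
have P1 : 2 * P`_1 = (n%:R - 2) * m`!%:R * (e1 ^+ 2 - e2).
  by rewrite P_coef mulrCA coef2_prod_XsubC ?size_s ?addn1 // c1.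
have P0 : 6 * P`_0 = - (m`!%:R * (e1 ^+ 3 - 3 * e1 * e2 + 2 * e3)).
  by rewrite P_coef mulrCA coef3_prod_XsubC ?size_s ?addn0 // c0 mulrN.
have nat_unit k : (0 < k)%N -> (k%:R : {mpoly R[n]}) \is a GRing.unit.
  by move=> ?; rewrite -mpolyC_nat rmorph_unit // unitfE pnatr_eq0 -lt0n.
(* The inverse in [Ddisc] cancels only against a unit; six times this coefficient is a positive
   integer. *)
have P3_unit : P`_3 \is a GRing.unit.
  have : 6 * P`_3 \is a GRing.unit; last by rewrite unitrM => /andP[].
  have -> : 6 * P`_3 = (m.+3 * m.+2 * m.+1 * m`!)%:R.
    by rewrite P3 !natrM nE -!natr1; ring.
  by rewrite nat_unit // !muln_gt0 fact_gt0.
have P3_neq0 : 3 * P`_3 != 0.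
  by rewrite mulf_neq0 //; [have := nat_unit 3%N isT | move: P3_unit];
    apply: contraTneq => ->; rewrite unitr0.
have size_P : size P = 4.
  apply/eqP; rewrite eqn_leq; apply/andP; split.
    apply/leq_sizeP => j j4; rewrite P_coef nth_default ?mulr0 //.
    by rewrite size_prod_XsubC size_s /n; lia.
  by rewrite ltnNge; apply: contra_neqN P3_neq0 => /leq_sizeP ->; rewrite ?mulr0.
(* The sign exponent is 3 * 2 / 2 = 3; this minus cancels the one in [resultant_cubic_deriv]. *)
have -> : Ddisc R n m = - (P`_3)^-1 * resultant P P^`().
  rewrite /Ddisc -derivnS -/P /lead_coef size_P -[n]/(3 + m)%N addnK /=.
  by rewrite -signr_odd expr1 mulN1r.
rewrite resultant_cubic_deriv // mulrA mulrNN mulVr // mul1r.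
have n2_neq0 : n%:R - 2 != 0 :> R by rewrite (subr_eq0 n%:R) (eqr_nat R n 2).
(* The cubic discriminant is homogeneous of degree 4 in the coefficients, so the factor [6 ^+ 4]
   lets each coefficient be replaced by its sixfold, which is known without division. *)
apply: (@mulfI _ (6 ^+ 4)).
  have := nat_unit 6%N isT; rewrite -(@unitrX_pos _ _ 4) //.
  by apply: contraTneq => ->; rewrite unitr0.
rewrite scalerBr scalerA [X in _ - X *: _](_ : _ =
  n%:R ^+ 2 * (n%:R - 1) ^+ 2 * (n%:R - 2) ^+ 2 * m`!%:R ^+ 4 / 12); last first.
  by field.
rewrite -!mul_mpolyC !(rmorphM, rmorphB, rmorphXn, rmorph_nat) /=.
set v := (12^-1)%:MP.
have v12 : 6 ^+ 4 * v = 108.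
  have -> : (6 : {mpoly R[n]}) ^+ 4 = (6 ^+ 4)%:MP by rewrite rmorphXn rmorph_nat.
  by rewrite -rmorphM -[RHS](mpolyC_nat n R); congr (_%:MP); field.
transitivity ((6 ^+ 4 * v) * (n%:R * (n%:R - 1) * ((n%:R - 2) * m`!%:R) ^+ 4
     * psum R n 2 ^+ 3
   - n%:R ^+ 2 * (n%:R - 1) ^+ 2 * (n%:R - 2) ^+ 2 * m`!%:R ^+ 4
     * psum R n 3 ^+ 2)); last by ring.
rewrite v12.
have P1' : 6 * P`_1 = 3 * ((n%:R - 2) * m`!%:R * (e1 ^+ 2 - e2)) by rewrite -P1; ring.
have P2' : 6 * P`_2 = - 3 * ((n%:R - 1) * (n%:R - 2) * m`!%:R * e1).
  by rewrite mulNr -mulrN -P2; ring.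
transitivity ((6 * P`_2) ^+ 2 * (6 * P`_1) ^+ 2 - 4 * (6 * P`_3) * (6 * P`_1) ^+ 3
    - 4 * (6 * P`_2) ^+ 3 * (6 * P`_0) - 27 * (6 * P`_3) ^+ 2 * (6 * P`_0) ^+ 2
    + 18 * (6 * P`_3) * (6 * P`_2) * (6 * P`_1) * (6 * P`_0)); first by ring.
rewrite P3 P2' P1' P0 s1 s2 s3; ring.
Qed.

(** * The square-graph cone *)

Section ConeClosure.
Variables (R : realFieldType) (n d : nat).

Lemma cone0 : square_graph_cone d (0 : {mpoly R[n]}).
Proof.
exists 0%N, (fun=> 0), (fun i : 'I_0 => False_rect _ (notF (ltn_ord i))).
by split=> [[]//|]; rewrite big_ord0.
Qed.

Lemma coneD (f g : {mpoly R[n]}) :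
  square_graph_cone d f -> square_graph_cone d g -> square_graph_cone d (f + g).
Proof.
move=> [N1 [c1 [G1 [h1 ->]]]] [N2 [c2 [G2 [h2 ->]]]].
exists (N1 + N2)%N, (fun a => match split a with inl b => c1 b | inr b => c2 b end),
  (fun a => match split a with inl b => G1 b | inr b => G2 b end).
split=> [a|]; first by case: (split a).
rewrite big_split_ord /=; congr (_ + _); apply: eq_bigr => a _.
  by rewrite (unsplitK (inl _ a)).
by rewrite (unsplitK (inr _ a)).
Qed.

Lemma coneZ (r : R) (f : {mpoly R[n]}) :
  0 <= r -> square_graph_cone d f -> square_graph_cone d (r *: f).
Proof.
move=> r_ge0 [N [c [G [h ->]]]]; exists N, (fun a => r * c a), G; split=> [a|].
  by have [c_ge0 ? ?] := h a; split; rewrite ?mulr_ge0.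
by rewrite scaler_sumr; apply: eq_bigr => a _; rewrite scalerA.
Qed.

Lemma cone_sum (I : Type) (s : seq I) (P : pred I) (F : I -> {mpoly R[n]}) :
  (forall i, P i -> square_graph_cone d (F i)) ->
  square_graph_cone d (\sum_(i <- s | P i) F i).
Proof. by move=> h; elim/big_ind: _ => //; [exact: cone0 | exact: coneD]. Qed.

Lemma cone_graph_sym (G : multigraph n) :
  square_graph G -> degree G = d -> square_graph_cone d (graph_sym R G).
Proof.
move=> sqG degG; exists 1%N, (fun=> 1), (fun=> G); split=> //.
by rewrite big_ord1 scale1r.
Qed.

Definition symmetrize (f : {mpoly R[n]}) := \sum_(s : 'S_n) msym s f.

Lemma symmetrizeD f g : symmetrize (f + g) = symmetrize f + symmetrize g.
Proof. by rewrite -big_split; apply: eq_bigr => s _; rewrite msymD. Qed.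

Lemma symmetrizeZ (c : R) f : symmetrize (c *: f) = c *: symmetrize f.
Proof. by rewrite scaler_sumr; apply: eq_bigr => s _; rewrite msymZ. Qed.

Lemma symmetrize_sum (I : Type) (s : seq I) (P : pred I) (F : I -> {mpoly R[n]}) :
  symmetrize (\sum_(i <- s | P i) F i) = \sum_(i <- s | P i) symmetrize (F i).
Proof. by rewrite exchange_big; apply: eq_bigr => t _; rewrite raddf_sum. Qed.

Lemma cone_symmetrize_sum (I : Type) (s : seq I) (P : pred I) (F : I -> {mpoly R[n]}) :
  (forall i, P i -> square_graph_cone d (symmetrize (F i))) ->
  square_graph_cone d (symmetrize (\sum_(i <- s | P i) F i)).
Proof. by move=> h; rewrite symmetrize_sum; apply: cone_sum. Qed.

(** All [n!] terms of the symmetrization equal [f], and [n!] is invertible in [R]. *)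
Lemma symmetrize_id f : (forall s, msym s f = f) -> f = (n`!%:R)^-1 *: symmetrize f.
Proof.
move=> fs; rewrite /symmetrize (eq_bigr (fun=> f)) // sumr_const card_Sn -scaler_nat.
by rewrite scalerA mulVf ?scale1r // pnatr_eq0 -lt0n fact_gt0.
Qed.

End ConeClosure.

(** * Square graphs from lists of doubled edges *)

Section DoubledEdges.
Variable n : nat.
Implicit Types (e : 'I_n * 'I_n) (es : seq ('I_n * 'I_n)).

Definition joins (i j : 'I_n) : pred ('I_n * 'I_n) := pred2 (i, j) (j, i).

(** Among the pairs [i < j] only the sorted endpoints of [e] contribute. The general monoid serves
    both the sum in [degree] and the product in [graph_monomial]. *)
Lemma big_joins (T : Type) (idx : T) (op : Monoid.com_law idx) (F : 'I_n -> 'I_n -> T) e :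
    e.1 != e.2 -> (forall i j, F i j = F j i) ->
  \big[op/idx]_(i < n) \big[op/idx]_(j < n | (i < j)%N)
    (if joins i j e then F i j else idx) = F e.1 e.2.
Proof.
case: e => a b /= ab Fs.
wlog lt_ab : a b ab / (a < b)%N.
  move=> h; case: (ltngtP a b) => [|ba|/val_inj eq]; first exact: h.
    rewrite Fs -h // 1?eq_sym //; do 2![apply: eq_bigr => ? _].
    by rewrite /joins /= !xpair_eqE orbC; congr (if _ || _ then _ else _); rewrite andbC.
  by rewrite eq eqxx in ab.
rewrite (bigD1 a) //= [X in op _ X]big1 => [|i ia].
  rewrite Monoid.mulm1 (bigD1 b) //= big1 => [|j /andP[_ jb]].
    by rewrite /joins /= eqxx Monoid.mulm1.
  rewrite /joins /= !xpair_eqE [b == j]eq_sym (negPf jb) andbF.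
  by rewrite [b == a]eq_sym (negPf ab) andbF.
rewrite big1 // => j ij; rewrite /joins /= !xpair_eqE [a == i]eq_sym (negPf ia) /=.
case: ifP => // /andP[/eqP aj /eqP bi]; subst; lia.
Qed.

(** Each occurrence in the list, in either direction, counts twice; the diagonal is set to 0 because
    a multigraph is loopless. *)
Definition edge_mult es (i j : 'I_n) : nat :=
  if i == j then 0%N else (count (joins i j) es).*2.

Lemma edge_mult_sym es i j : edge_mult es i j = edge_mult es j i.
Proof.
rewrite /edge_mult eq_sym; case: ifP => // _; congr (_.*2).
by apply: eq_count => e; rewrite /joins /= orbC.
Qed.

Lemma edge_mult_loopless es i : edge_mult es i i = 0%N.
Proof. by rewrite /edge_mult eqxx. Qed.

Lemma ltn_tournament (i j : 'I_n) : i != j -> (i < j)%N = ~~ (j < i)%N.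
Proof. by rewrite -val_eqE /=; lia. Qed.

(** Orientation by increasing index gives [graph_monomial] the same index pairs as [degree]. *)
Definition doubled_graph es : multigraph n :=
  @Multigraph n (edge_mult es) (fun i j => (i < j)%N)
    (edge_mult_sym es) (edge_mult_loopless es) ltn_tournament.

Lemma doubled_graph_square es : square_graph (doubled_graph es).
Proof. by move=> i j; rewrite /= /edge_mult; case: ifP => // _; rewrite odd_double. Qed.

Lemma edge_mult_cons e es (i j : 'I_n) : (i < j)%N ->
  edge_mult (e :: es) i j = ((if joins i j e then 2 else 0) + edge_mult es i j)%N.
Proof.
move=> ij; rewrite /edge_mult -val_eqE /= (ltn_eqF ij) doubleD.
by case: ifP.
Qed.

Lemma doubled_graph_degree es : all (fun e => e.1 != e.2) es ->
  degree (doubled_graph es) = (size es).*2.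
Proof.
rewrite /degree /=; elim: es => [|e es IH] /=.
  by rewrite big1 // => i _; rewrite big1 // => j _; rewrite /edge_mult if_same.
case/andP=> e12 /IH; rewrite doubleS => <-.
under eq_bigr do under eq_bigr => j ij do rewrite edge_mult_cons //.
under eq_bigr do rewrite big_split; rewrite big_split /=.
by rewrite (big_joins _ _ _ (fun _ _ => 2)).
Qed.

Lemma doubled_graph_monomial (R : realFieldType) es : all (fun e => e.1 != e.2) es ->
  graph_monomial R (doubled_graph es) = \prod_(e <- es) ('X_e.1 - 'X_e.2) ^+ 2.
Proof.
rewrite /graph_monomial /=; elim: es => [|e es IH] /=.
  rewrite big_nil big1 // => i _; rewrite big1 // => j _.
  by rewrite /edge_mult if_same expr0.
case/andP=> e12 /IH; rewrite big_cons => <-.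
under eq_bigr do under eq_bigr => j ij do rewrite edge_mult_cons // exprD.
under eq_bigr do rewrite big_split; rewrite big_split /=; congr (_ * _).
rewrite (eq_bigr (fun i : 'I_n => \prod_(j < n | (i < j)%N)
    (if joins i j e then ('X_i - 'X_j) ^+ 2 else 1))) => [|i _].
  by rewrite (big_joins _ _ _ (fun i j => ('X_i - 'X_j) ^+ 2)) // => i j; ring.
by apply: eq_bigr => j _; case: ifP.
Qed.

(* If the list contains a loop, the product is 0, which is in the cone. *)
Lemma cone_doubled_edges (R : realFieldType) es :
  square_graph_cone (size es).*2
    (symmetrize R n (\prod_(e <- es) ('X_e.1 - 'X_e.2) ^+ 2)).
Proof.
have [ok|] := boolP (all (fun e => e.1 != e.2) es).
  rewrite -doubled_graph_monomial //; apply: cone_graph_sym.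
    exact: doubled_graph_square.
  exact: doubled_graph_degree.
rewrite -has_predC => /hasP[e e_in /negPn/eqP e12].
rewrite (big_rem e) //= e12 subrr expr0n mul0r /symmetrize big1 => [|s _].
  exact: cone0.
exact: msym0.
Qed.

End DoubledEdges.

(** * Symmetry of the centred power sums, and the conclusion *)

Lemma z_sub (R : realFieldType) (n : nat) (i j : 'I_n) : z R i - z R j = 'X_i - 'X_j.
Proof. by rewrite /z; ring. Qed.

Lemma msym_z (R : realFieldType) (n : nat) (s : 'S_n) (i : 'I_n) :
  msym s (z R i) = z R (s i).
Proof.
have msymXi j : msym s ('X_j : {mpoly R[n]}) = 'X_(s j).
  rewrite msymX; congr 'X_[_]; apply/mnmP => k.
  by rewrite mnmE !mnm1E (can2_eq (permK s) (permKV s)).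
have msym_sum : msym s (\sum_(j < n) 'X_j : {mpoly R[n]}) = \sum_(j < n) 'X_j.
  by rewrite raddf_sum [RHS](reindex_perm s) /=; apply: eq_bigr => j _; apply: msymXi.
by rewrite /z /xbar msymB msymZ msymXi msym_sum.
Qed.

Lemma msym_psum (R : realFieldType) (n r : nat) (s : 'S_n) :
  msym s (psum R n r) = psum R n r.
Proof.
rewrite /psum raddf_sum [RHS](reindex_perm s) /=.
by apply: eq_bigr => i _; rewrite rmorphXn /= msym_z.
Qed.

Theorem theorem20 (R : realFieldType) (n : nat) (hn : (3 <= n)%N) :
  psum R n 2 ^+ 3
    - (n%:R * (n%:R - 1) / (n%:R - 2) ^+ 2) *: psum R n 3 ^+ 2
  = (6 / (n%:R * (n%:R - 2))) *: Tsum R n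
    + (1 / (2 * n%:R * (n%:R - 2))) *: Psum R n
    + (1 / (4 * n%:R * (n%:R - 2))) *: Qsum R n
    + (1 / (8 * n%:R * (n%:R - 2) ^+ 2)) *: Rsum R n
  /\ square_graph_cone 6 (Ddisc R n (n - 3)).
Proof.
have E := psum_identity R n hn; split=> //.
have -> : Ddisc R n (n - 3) =
  (n%:R * (n%:R - 1) * ((n%:R - 2) * (n - 3)`!%:R) ^+ 4 / 12) *:
     (psum R n 2 ^+ 3 - (n%:R * (n%:R - 1) / (n%:R - 2) ^+ 2) *: psum R n 3 ^+ 2).
  by case: n hn {E} => [|[|[|m]]] // _; rewrite -[m.+3]addn3 addnK addn3 Ddisc_psum.
have n_ge0 : 0 <= n%:R :> R := ler0n _ _.
have n1_ge0 : 0 <= n%:R - 1 :> R by rewrite subr_ge0 ler1n; lia.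
have n2_ge0 : 0 <= n%:R - 2 :> R by rewrite subr_ge0 (ler_nat R 2); lia.
apply: coneZ.
  by rewrite divr_ge0 // mulr_ge0 ?exprn_ge0 ?mulr_ge0.
(* The left-hand side of the identity is visibly symmetric, so it may be averaged before the
   identity is applied; each summand on the right is then symmetrized separately. *)
rewrite [X in square_graph_cone _ X]symmetrize_id => [|s]; last first.
  by rewrite msymB msymZ !rmorphXn /= !msym_psum.
apply: coneZ; first by rewrite invr_ge0 ler0n.
rewrite E !symmetrizeD !symmetrizeZ.
(* Three doubled edges have degree 6; coinciding indices are allowed. *)
have cone3 (a b a' b' a'' b'' : 'I_n) : square_graph_cone 6
    (symmetrize R n (('X_a - 'X_b) ^+ 2 * ('X_a' - 'X_b') ^+ 2 * ('X_a'' - 'X_b'') ^+ 2)).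
  have := cone_doubled_edges n R [:: (a, b); (a', b'); (a'', b'')].
  by rewrite !big_cons big_nil mulr1 mulrA.
do !apply: coneD; apply: coneZ; rewrite ?divr_ge0 ?mulr_ge0 ?exprn_ge0 //.
- by do 3![apply: cone_symmetrize_sum => ? _]; rewrite !z_sub.
- by do 4![apply: cone_symmetrize_sum => ? _]; rewrite !z_sub.
- do 4![apply: cone_symmetrize_sum => ? _]; rewrite !z_sub.
  (* A fourth power is the same doubled edge listed twice. *)
  by rewrite (exprM _ 2 2) [(_ ^+ 2) ^+ 2]expr2.
by do 6![apply: cone_symmetrize_sum => ? _]; rewrite !z_sub.
Qed.
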